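(* Consider the $r$-cGA (without frequency borders) maximizing $r$-OneMax on $\{0,\dots,r-1\}^n$, and suppose that at some time the frequency $p^{(t)}_{i,r-1}$ has reached a value of at least $k/r$, where $k>0$. Suppose $K\ge c\,r\sqrt{n}\log n$ for a sufficiently large constant $c$, and $K$ and $r$ are bounded by polynomials in $n$. Then, for a constant $c'>0$, the probability that $p^{(t)}_{i,r-1}$ drops below $k/r-1/(2r)$ within the next $T^{*}=c'K\sqrt{n}\log r$ iterations is at most $n^{-c''}$, where $c''\ge K/(288r\sqrt{n}\ln n)$.
   Context: Let $n\ge 1$, $r\ge 2$ be integers and $K>0$. $r$-OneMax$(x)=\sum_{i=1}^n \mathbf 1[x_i=r-1]$ for $x\in\{0,\dots,r-1\}^n$. The $r$-valued compact genetic algorithm ($r$-cGA) with parameter $K$ maintains frequencies $p^{(t)}_{i,j}$ for $i\in\{1,\dots,n\}$, $j\in\{0,\dots,r-1\}$, initially all $1/r$. In iteration $t$ it samples two strings $x,y$ independently, each position $i$ of each string taking value $j$ with probability $p^{(t)}_{i,j}$ independently of other positions; if $f(x)<f(y)$ then $x$ and $y$ are swapped; then for all $i,j$, $p^{(t+1)}_{i,j}=p^{(t)}_{i,j}+\frac1K(\mathbf 1[x_i=j]-\mathbf 1[y_i=j])$. Here $f$ is the function to be maximized. *)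

(* Defs.v *)
From HB Require Import structures.
From mathcomp Require Import all_boot all_order all_algebra.
From mathcomp Require Import reals exp.
Set Implicit Arguments. Unset Strict Implicit. Unset Printing Implicit Defensive.
Import Order.TTheory GRing.Theory Num.Theory.
Local Open Scope ring_scope.

Section RcGA.
Variables (R : realType) (n r : nat) (K : R).

Definition rstring := {ffun 'I_n -> 'I_r}.
Definition freqs := 'I_n -> 'I_r -> R.

Definition rOneMax (x : rstring) : nat := \sum_(i < n) ((x i : nat) == r.-1).

Definition init_freqs : freqs := fun _ _ => r%:R^-1.

Definition sample_prob (p : freqs) (x : rstring) : R := \prod_(i < n) p i (x i).

Definition cga_update (p : freqs) (x y : rstring) : freqs :=
  let: (w, l) := if (rOneMax x < rOneMax y)%N then (y, x) else (x, y) in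
  fun i j => p i j + K^-1 * (((w i == j) : nat)%:R - ((l i == j) : nat)%:R).

Inductive reachable : freqs -> Prop :=
| reach_init : reachable init_freqs
| reach_step p x y : reachable p -> 0 < sample_prob p x * sample_prob p y ->
    reachable (cga_update p x y).

(* probability that, starting from state p, the process is in a state
   satisfying [bad] at some time 0, 1, ..., T *)
Fixpoint hit_prob (bad : freqs -> bool) (T : nat) (p : freqs) : R :=
  if bad p then 1 else
  match T with
  | 0 => 0
  | T'.+1 => \sum_(x : rstring) \sum_(y : rstring)
       sample_prob p x * sample_prob p y * hit_prob bad T' (cga_update p x y)
  end.

End RcGA.

(* Main.v *)
(* The potential exp (K h (b - p_{i,r-1})) with h = 1/(144 sqrt n) is a supermartingale
   of the r-cGA, so the probability that p_{i,r-1} ever drops below b is at most its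
   initial value; for b = k/r - 1/(2r) <= p_{i,r-1} - 1/(2r) this is
   exp (-K/(288 r sqrt n)), whatever the number of iterations.
   In one step p_{i,r-1} moves by 1/K only if exactly one of the two samples has value
   r-1 at position i.  Positions are independent, so with w = p_{i,r-1} (1 - p_{i,r-1})
   it goes up with probability w U and down with probability w (2 - U), where U counts
   the ways the sample with r-1 at i wins (ties go to the first sample), and
   U >= 1 + Pr[S = S'] for the numbers S, S' of entries r-1 at the other positions.
   Since Var S <= n, Chebyshev puts mass 3/4 on a window of at most 4 sqrt n + 2 values
   of S, and Cauchy-Schwarz gives Pr[S = S'] >= 1/(144 sqrt n) >= h, which is what makes
   the potential decrease in expectation. *)

Require Import Defs.
From HB Require Import structures.
From mathcomp Require Import all_boot all_order all_algebra perm.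
From mathcomp Require Import reals sequences exp.
From mathcomp Require Import ring lra zify.
Set Implicit Arguments. Unset Strict Implicit. Unset Printing Implicit Defensive.
Import Order.TTheory GRing.Theory Num.Theory.
Local Open Scope ring_scope.

Lemma sum_mul_indicator (R : pzSemiRingType) (I : finType) (F : I -> R) (u : I) :
  \sum_v F v * (v == u)%:R = F u.
Proof.
rewrite (bigD1 u) //= eqxx mulr1 big1 ?addr0 // => v /negPf vNu.
by rewrite vNu mulr0.
Qed.

Section ProductDistribution.
Variables (R : realType) (n r : nat) (p : freqs R n r).
Local Notation rstring := (rstring n r).
Local Notation sp := (sample_prob p).

Definition upd (x : rstring) (a : 'I_n) (v : 'I_r) : rstring :=
  [ffun b => if b == a then v else x b].

Lemma sum_fiber_eq (a : 'I_n) (M : rstring -> R) (v v' : 'I_r) :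
  (forall x u, M (upd x a u) = M x) ->
  \sum_(x : rstring) (x a == v)%:R * M x = \sum_(x : rstring) (x a == v')%:R * M x.
Proof.
move=> M_upd; pose s (x : rstring) := upd x a (tperm v v' (x a)).
have sK : involutive s.
  by move=> x; apply/ffunP => b; rewrite !ffunE; case: eqP => [->|//]; rewrite eqxx tpermK.
rewrite (reindex_inj (inv_inj sK)); apply: eq_bigr => x _.
by rewrite /s M_upd ffunE eqxx (canF_eq (tpermK v v')) tpermL.
Qed.

Lemma sum_coord_mul (a : 'I_n) (al : 'I_r -> R) (M : rstring -> R) (v' : 'I_r) :
  (forall x u, M (upd x a u) = M x) ->
  \sum_(x : rstring) al (x a) * M x =
  (\sum_v al v) * \sum_(x : rstring) (x a == v')%:R * M x.
Proof.
move=> M_upd; rewrite mulr_suml.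
under eq_bigr => x _ do rewrite -(sum_mul_indicator al (x a)) mulr_suml.
rewrite exchange_big; apply: eq_bigr => v _.
under eq_bigr => x _ do rewrite eq_sym -mulrA.
by rewrite -mulr_sumr (sum_fiber_eq v v' M_upd).
Qed.

Lemma sample_prob_split (a : 'I_n) (x : rstring) :
  sp x = p a (x a) * \prod_(b | b != a) p b (x b).
Proof. by rewrite /sample_prob (bigD1 a). Qed.

Lemma sum_sample_prob_indep (a : 'I_n) (g : 'I_r -> R) (F : rstring -> R) :
  \sum_v p a v = 1 -> (forall x u, F (upd x a u) = F x) ->
  \sum_(x : rstring) sp x * (g (x a) * F x) =
  (\sum_v p a v * g v) * \sum_(x : rstring) sp x * F x.
Proof.
move=> row1 F_upd.
have [v' _ | r0] := pickP (fun _ : 'I_r => true); last first.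
  by move: row1; rewrite big_pred0 // => /eqP; rewrite eq_sym oner_eq0.
pose M (x : rstring) := (\prod_(b | b != a) p b (x b)) * F x.
have M_upd (x : rstring) u : M (upd x a u) = M x.
  rewrite /M F_upd; congr (_ * _); apply: eq_bigr => b /negPf bNa.
  by rewrite ffunE bNa.
have -> : \sum_(x : rstring) sp x * (g (x a) * F x) =
          \sum_(x : rstring) (p a (x a) * g (x a)) * M x.
  by apply: eq_bigr => x _; rewrite (sample_prob_split a) /M; ring.
have -> : \sum_(x : rstring) sp x * F x = \sum_(x : rstring) p a (x a) * M x.
  by apply: eq_bigr => x _; rewrite (sample_prob_split a) /M; ring.
rewrite (sum_coord_mul (fun v => p a v * g v) v' M_upd).
rewrite (sum_coord_mul (p a) v' M_upd).
by rewrite row1 mul1r.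
Qed.

Lemma sum_sample_prob : (forall a, \sum_v p a v = 1) -> \sum_(x : rstring) sp x = 1.
Proof. by move=> row1; rewrite -(bigA_distr_bigA p) big1. Qed.

End ProductDistribution.

Section Admissible.
Variables (R : realType) (n r : nat) (K : R).
Local Notation rstring := (rstring n r).
Local Notation freqs := (freqs R n r).

(* The grid (1/K)N keeps frequencies nonnegative: an entry only decreases when its
   value was sampled, hence when it is positive, hence at least 1/K. *)
Definition admissible (p : freqs) : Prop :=
  (forall a v, exists m : nat, p a v = m%:R / K) /\ (forall a, \sum_v p a v = 1).

Hypothesis K_gt0 : 0 < K.

Lemma admissible_ge0 (p : freqs) : admissible p -> forall a v, 0 <= p a v.
Proof. by case=> grid _ a v; have [m ->] := grid a v; rewrite divr_ge0 // ltW. Qed.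

Lemma admissible_move (p : freqs) (w l : rstring) :
  admissible p -> sample_prob p l != 0 ->
  admissible (fun a v => p a v + K^-1 * ((w a == v)%:R - (l a == v)%:R)).
Proof.
move=> [grid row1] l_pos; split=> [a v|a]; last first.
  have sum_eq1 (u : 'I_r) : \sum_v ((u == v)%:R : R) = 1.
    by under eq_bigr do rewrite -[_%:R]mul1r eq_sym; rewrite sum_mul_indicator.
  by rewrite big_split /= row1 -mulr_sumr sumrB !sum_eq1 subrr mulr0 addr0.
have [m pm] := grid a v; rewrite pm.
case: (w a =P v) => wv; case: (l a =P v) => lv /=.
- by exists m; rewrite subrr mulr0 addr0.
- by exists m.+1; rewrite subr0 mulr1 -natr1 mulrDl div1r.
- have : p a (l a) != 0.
    by move: l_pos; rewrite (sample_prob_split _ a) mulf_eq0 negb_or => /andP[].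
  rewrite lv pm; case: m {pm} => [|m _]; first by rewrite mul0r eqxx.
  by exists m; rewrite sub0r mulrN1 -natr1 mulrDl div1r addrK.
- by exists m; rewrite subrr mulr0 addr0.
Qed.

Lemma admissible_step (p : freqs) (x y : rstring) :
  admissible p -> 0 < sample_prob p x * sample_prob p y ->
  admissible (cga_update K p x y).
Proof.
move=> adm /gt_eqF/negbT; rewrite mulf_eq0 negb_or => /andP[x_pos y_pos].
by rewrite /cga_update; case: ifP => _; apply: admissible_move.
Qed.

Lemma reachable_admissible (p : freqs) :
  (exists m : nat, K = (m * r)%:R) -> reachable K p -> admissible p.
Proof.
move=> [m Kmr]; elim=> [|q x y _ adm_q pos]; last exact: admissible_step.
have [m_gt0 r_gt0] : (0 < m)%N /\ (0 < r)%N.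
  by apply/andP; rewrite -muln_gt0 -(ltr0n R) -Kmr.
split=> [a v|a].
  by exists m; rewrite Kmr natrM invfM mulrA divff ?mul1r ?pnatr_eq0 -?lt0n.
by rewrite /init_freqs sumr_const card_ord -(mulr_natr r%:R^-1) mulVf // pnatr_eq0 -lt0n.
Qed.

End Admissible.

Lemma card_pred_le (n : nat) (A : pred 'I_n) : (#|A| <= n)%N.
Proof. by rewrite -[X in (_ <= X)%N]card_ord max_card. Qed.

Lemma sqr_sum_le_card (R : realFieldType) (I : finType) (J : {pred I}) (F : I -> R) :
  (\sum_(k in J) F k) ^+ 2 <= #|J|%:R * \sum_(k in J) F k ^+ 2.
Proof.
set M := \sum_(k in J) F k; set Q := \sum_(k in J) F k ^+ 2.
have [J0|J_gt0] := posnP #|J|.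
  by rewrite /M big_pred0 => [|k]; rewrite ?card0_eq // J0 expr0n mul0r.
have N_gt0 : 0 < #|J|%:R :> R by rewrite ltr0n.
have : 0 <= \sum_(k in J) (#|J|%:R * F k - M) ^+ 2.
  by apply: sumr_ge0 => k _; exact: sqr_ge0.
rewrite (eq_bigr (fun k => #|J|%:R ^+ 2 * F k ^+ 2 - 2 * #|J|%:R * M * F k + M ^+ 2));
  last by move=> k _; ring.
rewrite big_split sumrB /= -!mulr_sumr sumr_const -/M -/Q -mulr_natr.
nra.
Qed.

Lemma card_window_le (R : archiRealFieldType) (N : nat) (c t : R) : 0 <= t ->
  #|[pred k : 'I_N | `|k%:R - c| < t]|%:R <= 2 * t + 2.
Proof.
move=> t_ge0; set m := Num.truncn (c - t); set T := (Num.truncn (2 * t)).+1.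
have window (k : nat) : `|k%:R - c| < t -> (m <= k <= m + T)%N.
  rewrite ltr_distl => /andP[lo hi]; rewrite truncn_le_nat -ltnS -(ltr_nat R).
  have := truncnS_gt (c - t); have := truncnS_gt (2 * t).
  rewrite -/m -/T -[(m + T).+1]addn1 !natrD -!natr1; lra.
have inj : {in [pred k : 'I_N | `|k%:R - c| < t] &,
            injective (fun k : 'I_N => inord (k - m) : 'I_T.+1)}.
  move=> k k' /window /andP[k_ge k_le] /window /andP[k'_ge k'_le] /(congr1 val).
  by rewrite /= !inordK ?ltnS ?leq_subLR // => /eqP; rewrite eqn_sub2rE // => /eqP/val_inj.
apply: le_trans (_ : T.+1%:R <= _).
  by rewrite ler_nat -[X in (_ <= X)%N]card_ord (leq_card_in _ _ inj).
have := truncn_le (2 * t); rewrite mulr_ge0 // => trunc_le.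
by rewrite /T -addn2 (natrD _ _ 2); lra.
Qed.

Lemma expR_balance (R : realType) (h s : R) : 0 <= h -> 1 + h <= s ->
  (expR (- h) - 1) * s + (expR h - 1) * (2 - s) <= 0.
Proof.
move=> h_ge0 hs; have u_gt0 := expR_gt0 h; set u := expR h in u_gt0 *.
have u_ge1 : 1 <= u by rewrite /u -expR0 ler_expR.
have u_le : u * (1 - h) <= 1.
  rewrite -[X in _ <= X](mulfV (lt0r_neq0 u_gt0)) ler_pM2l // /u -expRN.
  by have := expR_ge1Dx (- h); lra.
have -> : (expR (- h) - 1) * s + (u - 1) * (2 - s) = u^-1 * ((u - 1) * (u * (2 - s) - s)).
  by rewrite expRN -/u; field; rewrite gt_eqF.
by rewrite pmulr_rle0 ?invr_gt0 //; apply: mulr_ge0_le0; nra.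
Qed.

Section PairExpectation.
Variables (R : realType) (n r : nat) (p : freqs R n r).
Hypotheses (p_ge0 : forall a v, 0 <= p a v) (row1 : forall a, \sum_v p a v = 1).
Local Notation rstring := (rstring n r).
Local Notation sp := (sample_prob p).

Lemma sample_prob_ge0 (x : rstring) : 0 <= sp x.
Proof. by apply: prodr_ge0 => a _; exact: p_ge0. Qed.

Lemma freq_le1 a v : p a v <= 1.
Proof. by rewrite -(row1 a) (bigD1 v) //= lerDl sumr_ge0. Qed.

Definition Epair (G : rstring -> rstring -> R) : R :=
  \sum_(x : rstring) \sum_(y : rstring) sp x * sp y * G x y.

Lemma eq_Epair (G1 G2 : rstring -> rstring -> R) :
  (forall x y, G1 x y = G2 x y) -> Epair G1 = Epair G2.
Proof. by move=> eqG; apply: eq_bigr => x _; apply: eq_bigr => y _; rewrite eqG. Qed.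

Lemma Epair1 : Epair (fun _ _ => 1) = 1.
Proof.
rewrite /Epair -[RHS](sum_sample_prob row1); apply: eq_bigr => x _.
by under eq_bigr do rewrite mulr1; rewrite -mulr_sumr sum_sample_prob // mulr1.
Qed.

Lemma EpairD (G1 G2 : rstring -> rstring -> R) :
  Epair (fun x y => G1 x y + G2 x y) = Epair G1 + Epair G2.
Proof.
rewrite /Epair -big_split; apply: eq_bigr => x _.
by rewrite -big_split; apply: eq_bigr => y _; rewrite mulrDr.
Qed.

Lemma EpairZ c (G : rstring -> rstring -> R) :
  Epair (fun x y => c * G x y) = c * Epair G.
Proof.
rewrite /Epair mulr_sumr; apply: eq_bigr => x _.
by rewrite mulr_sumr; apply: eq_bigr => y _; rewrite mulrCA.
Qed.

Lemma ler_Epair (G1 G2 : rstring -> rstring -> R) :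
  (forall x y, G1 x y <= G2 x y) -> Epair G1 <= Epair G2.
Proof.
move=> leG; apply: ler_sum => x _; apply: ler_sum => y _.
by rewrite ler_wpM2l // mulr_ge0 // sample_prob_ge0.
Qed.

Lemma Epair_indep a (g1 g2 : 'I_r -> R) (G : rstring -> rstring -> R) :
  (forall x y u, G (upd x a u) y = G x y) -> (forall x y u, G x (upd y a u) = G x y) ->
  Epair (fun x y => g1 (x a) * g2 (y a) * G x y) =
  (\sum_v p a v * g1 v) * (\sum_v p a v * g2 v) * Epair G.
Proof.
move=> G_updl G_updr.
have inner (x : rstring) : \sum_(y : rstring) sp x * sp y * (g1 (x a) * g2 (y a) * G x y) =
    sp x * (g1 (x a) * ((\sum_v p a v * g2 v) * \sum_(y : rstring) sp y * G x y)).
  rewrite -(sum_sample_prob_indep g2 (row1 a)) // !mulr_sumr.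
  by apply: eq_bigr => y _; ring.
rewrite /Epair; under eq_bigr do rewrite inner.
rewrite (sum_sample_prob_indep g1 (row1 a)) => [|x u]; last first.
  by congr (_ * _); apply: eq_bigr => y _; rewrite G_updl.
rewrite -mulrA; congr (_ * _); rewrite mulr_sumr; apply: eq_bigr => x _.
by rewrite mulrCA mulr_sumr; congr (_ * _); apply: eq_bigr => y _; rewrite mulrA.
Qed.

Section Collision.
Variables (P : pred 'I_n) (v : 'I_r).

Definition occ (x : rstring) : nat := \sum_(b | P b) (x b == v).

Definition occ_prob (k : nat) : R := \sum_(x : rstring) sp x * (occ x == k)%:R.

Definition occ_mean : R := \sum_(b | P b) p b v.

Definition occ_var : R := \sum_(x : rstring) sp x * ((occ x)%:R - occ_mean) ^+ 2.

Definition collision : R := Epair (fun x y => (occ x == occ y)%:R).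

Lemma occ_le (x : rstring) : (occ x <= n)%N.
Proof.
apply: leq_trans (card_pred_le P); rewrite -sum1_card.
by apply: leq_sum => b _; exact: leq_b1.
Qed.

Lemma sum_occ_prob (F : nat -> R) :
  \sum_(k < n.+1) occ_prob k * F k = \sum_(x : rstring) sp x * F (occ x).
Proof.
under eq_bigr do rewrite mulr_suml.
rewrite exchange_big; apply: eq_bigr => x _.
have occ_lt : (occ x < n.+1)%N by rewrite ltnS occ_le.
rewrite (bigD1 (Ordinal occ_lt)) //= eqxx mulr1 big1 ?addr0 // => k.
by rewrite -val_eqE eq_sym /= => /negPf ->; rewrite mulr0 mul0r.
Qed.

Lemma collision_sum_sqr : collision = \sum_(k < n.+1) occ_prob k ^+ 2.
Proof.
under [RHS]eq_bigr do rewrite expr2.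
rewrite sum_occ_prob; apply: eq_bigr => x _; rewrite mulr_sumr.
by apply: eq_bigr => y _; rewrite eq_sym mulrA.
Qed.

Lemma occ_var_le : occ_var <= n%:R.
Proof.
pose D b (x : rstring) := (x b == v)%:R - p b v.
have cov0 a b : a != b -> \sum_(x : rstring) sp x * (D a x * D b x) = 0.
  move=> aNb; rewrite (sum_sample_prob_indep (fun u => (u == v)%:R - p a v) (row1 a)).
    rewrite (eq_bigr (fun u => p a u * (u == v)%:R - p a u * p a v)) => [|u _]; last first.
      by rewrite mulrBr.
    by rewrite sumrB sum_mul_indicator -mulr_suml row1 mul1r subrr mul0r.
  by move=> x u; rewrite /D ffunE (ifN_eqC _ _ aNb).
have var1 a : \sum_(x : rstring) sp x * (D a x * D a x) <= 1.
  rewrite -(sum_sample_prob row1); apply: ler_sum => x _.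
  rewrite ler_piMr ?sample_prob_ge0 //.
  by have := p_ge0 a v; have := freq_le1 a v; rewrite /D; case: (x a == v) => /=; nra.
have dev x : (occ x)%:R - occ_mean = \sum_(a | P a) D a x.
  by rewrite /occ natr_sum /occ_mean -sumrB.
have -> : occ_var = \sum_(a | P a) \sum_(b | P b) \sum_(x : rstring) sp x * (D a x * D b x).
  transitivity (\sum_(x : rstring) \sum_(a | P a) \sum_(b | P b) sp x * (D a x * D b x)).
    apply: eq_bigr => x _; rewrite dev expr2 mulr_suml mulr_sumr.
    by apply: eq_bigr => a _; rewrite !mulr_sumr.
  by rewrite exchange_big; apply: eq_bigr => a _; exact: exchange_big.
apply: le_trans (_ : \sum_(a | P a) 1 <= _).
  apply: ler_sum => a Pa; rewrite (bigD1 a) //= [X in _ + X]big1 ?addr0; first exact: var1.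
  by move=> b /andP[_ bNa]; apply: cov0; rewrite eq_sym.
by rewrite sumr_const -mulr_natr mul1r ler_nat card_pred_le.
Qed.

Lemma occ_window_mass (t : R) : 0 < t ->
  1 - occ_var / t ^+ 2 <= \sum_(k < n.+1 | `|k%:R - occ_mean| < t) occ_prob k.
Proof.
move=> t_gt0; pose near (k : nat) : R := ((`|k%:R - occ_mean| < t)%R)%:R.
rewrite big_mkcond (eq_bigr (fun k : 'I_n.+1 => occ_prob k * near k)) => [|k _]; last first.
  by rewrite /near; case: ifP; rewrite ?mulr1 ?mulr0.
rewrite (sum_occ_prob near).
rewrite -[X in X - _ <= _](sum_sample_prob row1) /occ_var mulr_suml -sumrB.
apply: ler_sum => x _; rewrite -mulrA -[X in X - _]mulr1 -mulrBr.
rewrite ler_wpM2l ?sample_prob_ge0 // /near; set d := _ - occ_mean.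
have := sqr_ge0 d; have t2_gt0 : 0 < t ^+ 2 by rewrite exprn_gt0.
case: ltrP => [_|t_le_d] /= d2_ge0; first by rewrite lerBlDr lerDl divr_ge0 // ltW.
rewrite subr_le0 ler_pdivlMr // mul1r -(real_normK (num_real d)).
by have := normr_ge0 d; nra.
Qed.

Lemma collision_ge : (0 < n)%N -> (144 * Num.sqrt n%:R)^-1 <= collision.
Proof.
move=> n_gt0; set s := Num.sqrt n%:R.
have s_ge1 : 1 <= s by rewrite -sqrtr1 ler_sqrt // ler1n.
have s2 : s ^+ 2 = n%:R by rewrite sqr_sqrtr.
set J := [pred k : 'I_n.+1 | `|k%:R - occ_mean| < 2 * s].
set M := \sum_(k in J) occ_prob k; set Q := \sum_(k in J) occ_prob k ^+ 2.
have occ_prob_ge0 k : 0 <= occ_prob k.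
  by apply: sumr_ge0 => x _; rewrite mulr_ge0 ?sample_prob_ge0.
have M_ge : 3 / 4 <= M.
  apply: le_trans (occ_window_mass _) => //; last lra.
  have : occ_var / (2 * s) ^+ 2 <= 1 / 4.
    rewrite exprMn s2 ler_pdivrMr ?mulr_gt0 ?ltr0n //.
    by have := occ_var_le; lra.
  lra.
have J_le : #|J|%:R <= 6 * s by apply: le_trans (card_window_le _ _ _) _; lra.
have Q_le : Q <= collision.
  rewrite collision_sum_sqr [X in _ <= X](bigID J) /= lerDl.
  by apply: sumr_ge0 => k _; exact: sqr_ge0.
have M2_le : M ^+ 2 <= 6 * s * collision.
  apply: le_trans (sqr_sum_le_card J occ_prob) _.
  by apply: ler_pM => //; apply: sumr_ge0 => k _; exact: sqr_ge0.
rewrite -[X in X <= _]div1r ler_pdivrMr; last by rewrite mulr_gt0 //; lra.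
by nra.
Qed.
End Collision.

Section TopFrequency.
Variables (i : 'I_n) (j : 'I_r).

Definition top_at (x : rstring) : bool := x i == j.

Definition tops_off (x : rstring) : nat := occ (predC1 i) j x.

Lemma tops_off_upd (x : rstring) u : tops_off (upd x i u) = tops_off x.
Proof. by apply: eq_bigr => b /negPf bNi; rewrite ffunE bNi. Qed.

Lemma rOneMax_top : (j : nat) = r.-1 -> forall x, rOneMax x = (top_at x + tops_off x)%N.
Proof.
move=> top_j x; rewrite /rOneMax (bigD1 i) //= -top_j.
by congr (_ + _)%N; apply: eq_bigr => b _; rewrite val_eqE.
Qed.

Definition split_top (G1 G2 : nat -> nat -> R) (x y : rstring) : R :=
  (top_at x)%:R * (~~ top_at y)%:R * G1 (tops_off x) (tops_off y) +
  (~~ top_at x)%:R * (top_at y)%:R * G2 (tops_off x) (tops_off y).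

Lemma Epair_split_top (G1 G2 : nat -> nat -> R) :
  Epair (split_top G1 G2) =
  p i j * (1 - p i j) *
  Epair (fun x y => G1 (tops_off x) (tops_off y) + G2 (tops_off x) (tops_off y)).
Proof.
have top_mass : \sum_v p i v * (v == j)%:R = p i j by exact: sum_mul_indicator.
have off_mass : \sum_v p i v * (v != j)%:R = 1 - p i j.
  transitivity (\sum_v (p i v - p i v * (v == j)%:R)); last by rewrite sumrB row1 top_mass.
  by apply: eq_bigr => v _; case: (v == j); rewrite ?mulr0 ?mulr1 ?subr0 ?subrr.
have updl (G : nat -> nat -> R) x y u :
    G (tops_off (upd x i u)) (tops_off y) = G (tops_off x) (tops_off y).
  by rewrite tops_off_upd.
have updr (G : nat -> nat -> R) x y u :
    G (tops_off x) (tops_off (upd y i u)) = G (tops_off x) (tops_off y).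
  by rewrite tops_off_upd.
rewrite /split_top /top_at [LHS]EpairD.
have := Epair_indep (fun v => (v == j)%:R) (fun v => (v != j)%:R) (updl G1) (updr G1).
have := Epair_indep (fun v => (v != j)%:R) (fun v => (v == j)%:R) (updl G2) (updr G2).
rewrite /= => -> ->.
by rewrite top_mass off_mass EpairD; ring.
Qed.

(* K times the change of p i j in one step is gain - loss; the two cases are asymmetric
   because cga_update lets the first sample win ties. *)
Definition gain : rstring -> rstring -> R :=
  split_top (fun a b => (b <= a + 1)%:R) (fun a b => (a <= b)%:R).

Definition loss : rstring -> rstring -> R :=
  split_top (fun a b => (a + 1 < b)%:R) (fun a b => (b < a)%:R).

Lemma cga_update_top (K : R) : (j : nat) = r.-1 -> forall x y,
  cga_update K p x y i j = p i j + K^-1 * (gain x y - loss x y).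
Proof.
move=> top_j x y.
have -> : cga_update K p x y i j = p i j + K^-1 * (if (rOneMax x < rOneMax y)%N
    then (y i == j)%:R - (x i == j)%:R else (x i == j)%:R - (y i == j)%:R).
  by rewrite /cga_update; case: ifP.
rewrite !(rOneMax_top top_j) /gain /loss /split_top /top_at.
congr (_ + _ * _).
case: (x i == j); case: (y i == j); rewrite /= ?add0n ?add1n ?addn0 ?addn1 ?ltnS.
- by rewrite if_same; ring.
- by case: (ltnP (tops_off x).+1 (tops_off y)) => _ /=; ring.
- by case: (leqP (tops_off x) (tops_off y)) => _ /=; ring.
- by rewrite if_same; ring.
Qed.

Lemma fun_gain_loss (f : R -> R) x y :
  f (gain x y - loss x y) = f 0 + (f 1 - f 0) * gain x y + (f (-1) - f 0) * loss x y.
Proof.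
rewrite /gain /loss /split_top; case: (top_at x); case: (top_at y) => /=.
- by rewrite !(mul0r, mulr0, mul1r, addr0, subrr); ring.
- by case: (ltnP (tops_off x + 1) (tops_off y)) => _;
    rewrite !(mul0r, mulr0, mul1r, mulr1, addr0, subr0, sub0r); ring.
- by case: (leqP (tops_off x) (tops_off y)) => _;
    rewrite !(mul0r, mulr0, mul1r, mulr1, addr0, add0r, subr0, sub0r); ring.
- by rewrite !(mul0r, mulr0, mul1r, addr0, subrr); ring.
Qed.

Definition win_mass : R :=
  Epair (fun x y => (tops_off y <= tops_off x + 1)%:R + (tops_off x <= tops_off y)%:R).

Lemma Epair_gain : Epair gain = p i j * (1 - p i j) * win_mass.
Proof. exact: Epair_split_top. Qed.

Lemma Epair_loss : Epair loss = p i j * (1 - p i j) * (2 - win_mass).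
Proof.
rewrite Epair_split_top; congr (_ * _).
transitivity (Epair (fun x y => 2 * 1 +
    (-1) * ((tops_off y <= tops_off x + 1)%:R + (tops_off x <= tops_off y)%:R))).
  apply: eq_Epair => x y; rewrite !ltnNge.
  by case: (tops_off y <= _)%N; case: (tops_off x <= _)%N => /=; ring.
by rewrite EpairD !EpairZ Epair1 mulr1 mulN1r.
Qed.

Lemma win_mass_ge : 1 + collision (predC1 i) j <= win_mass.
Proof.
rewrite -Epair1 -EpairD; apply: ler_Epair => x y.
rewrite -[1 + _](natrD _ 1) -natrD ler_nat.
by case: (ltngtP (tops_off x) (tops_off y)) => /=; lia.
Qed.

Lemma Epair_expR_drift (h : R) : 0 <= h -> h <= collision (predC1 i) j ->
  Epair (fun x y => expR (- (h * (gain x y - loss x y)))) <= 1.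
Proof.
move=> h_ge0 h_le_collision.
have expR_jump x y : expR (- (h * (gain x y - loss x y))) =
    1 + (expR (- h) - 1) * gain x y + (expR h - 1) * loss x y.
  rewrite (fun_gain_loss (fun d => expR (- (h * d)))).
  by rewrite mulr0 oppr0 expR0 mulr1 mulrN1 opprK.
rewrite (eq_Epair expR_jump) !EpairD !EpairZ Epair1 Epair_gain Epair_loss.
have w_ge0 : 0 <= p i j * (1 - p i j) by rewrite mulr_ge0 // subr_ge0 freq_le1.
have h_win : 1 + h <= win_mass by apply: le_trans win_mass_ge; rewrite lerD2l.
have := expR_balance h_ge0 h_win; nra.
Qed.

End TopFrequency.
End PairExpectation.

Section Hitting.
Variables (R : realType) (n r : nat) (K : R).
Hypothesis K_gt0 : 0 < K.
Local Notation freqs := (freqs R n r).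

Lemma hit_prob_le_potential (bad : pred freqs) (Phi : freqs -> R) :
  (forall q, 0 <= Phi q) -> (forall q, bad q -> 1 <= Phi q) ->
  (forall q, admissible K q -> ~~ bad q ->
     Epair q (fun x y => Phi (cga_update K q x y)) <= Phi q) ->
  forall T q, admissible K q -> hit_prob K bad T q <= Phi q.
Proof.
move=> Phi_ge0 Phi_bad Phi_super; elim=> [|T IH] q adm /=;
  case: ifP => [/Phi_bad //|q_good]; first exact: Phi_ge0.
apply: le_trans (Phi_super q adm (negbT q_good)).
apply: ler_sum => x _; apply: ler_sum => y _.
have sp_ge0 := sample_prob_ge0 (admissible_ge0 K_gt0 adm).
have [w_gt0|w_le0] := ltrP 0 (sample_prob q x * sample_prob q y).
  by rewrite ler_pM2l // IH //; exact: admissible_step.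
have -> : sample_prob q x * sample_prob q y = 0.
  by apply/eqP; rewrite eq_le w_le0 mulr_ge0.
by rewrite !mul0r.
Qed.

Lemma hit_prob_top_le (i : 'I_n) (j : 'I_r) (b h : R) :
  (j : nat) = r.-1 -> 0 <= h -> h <= (144 * Num.sqrt n%:R)^-1 ->
  forall T p, admissible K p ->
  hit_prob K (fun q => q i j < b) T p <= expR (K * h * (b - p i j)).
Proof.
move=> top_j h_ge0 h_le; have n_gt0 : (0 < n)%N by case: n i => [[]|].
apply: hit_prob_le_potential => [q|q q_bad|q adm _]; first exact: expR_ge0.
  rewrite -expR0 ler_expR; apply: mulr_ge0; first by rewrite mulr_ge0 // ltW.
  by rewrite subr_ge0 ltW.
have q_ge0 := admissible_ge0 K_gt0 adm.
have h_collision := le_trans h_le (collision_ge q_ge0 adm.2 (predC1 i) j n_gt0).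
rewrite (eq_Epair q (G2 := fun x y =>
    expR (K * h * (b - q i j)) * expR (- (h * (gain R i j x y - loss R i j x y))))).
  by rewrite EpairZ ler_piMr ?expR_ge0 ?(Epair_expR_drift q_ge0 adm.2 h_ge0 h_collision).
move=> x y; rewrite (cga_update_top _ _ K top_j) -expRD; congr expR.
by field; rewrite lt0r_neq0.
Qed.

End Hitting.

Theorem lemma2 (R : realType) (d : nat) :
  exists c c' : R, 0 < c' /\ exists n0 : nat,
  forall (n r : nat) (K : R),
    (n0 <= n)%N -> (2 <= r)%N ->
    (exists m : nat, K = (m * r)%:R) ->
    c * r%:R * Num.sqrt n%:R * ln n%:R <= K ->
    K <= n%:R ^+ d -> (r <= n ^ d)%N ->
    forall (i : 'I_n) (j : 'I_r), (j : nat) = r.-1 ->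
    forall (k : R), 0 < k ->
    forall p : freqs R n r, reachable K p ->
    k / r%:R <= p i j ->
    forall T : nat, T%:R <= c' * K * Num.sqrt n%:R * ln r%:R ->
    hit_prob K (fun q => q i j < k / r%:R - (2 * r%:R)^-1) T p
      <= n%:R `^ (- (K / (288 * r%:R * Num.sqrt n%:R * ln n%:R))).
Proof.
exists 1, 1; split => //; exists 2%N.
move=> n r K n_ge2 r_ge2 Kmr K_ge _ _ i j top_j k k_gt0 p p_reach k_le T _.
set s := Num.sqrt n%:R; set L := ln n%:R.
have n_gt1 : 1 < n%:R :> R by rewrite ltr1n.
have s_ge1 : 1 <= s by rewrite -sqrtr1 ler_sqrt // ltW.
have L_gt0 : 0 < L by exact: ln_gt0.
have r_gt0 : 0 < r%:R :> R by rewrite ltr0n (leq_trans _ r_ge2).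
have K_gt0 : 0 < K.
  apply: lt_le_trans K_ge; rewrite mul1r -/s -/L.
  by apply: mulr_gt0 => //; apply: mulr_gt0 => //; lra.
have h_ge0 : 0 <= (144 * s)^-1 by rewrite invr_ge0; lra.
apply: le_trans (hit_prob_top_le K_gt0 i _ top_j h_ge0 (lexx _) T
                   (reachable_admissible K_gt0 Kmr p_reach)) _.
rewrite /powR ifF ?pnatr_eq0 ?gtn_eqF ?(ltn_trans _ n_ge2) // ler_expR.
have -> : - (K / (288 * r%:R * s * L)) * L = K * (144 * s)^-1 * - (2 * r%:R)^-1.
  by field; rewrite !lt0r_neq0 //; lra.
by apply: ler_wpM2l; [rewrite mulr_ge0 // ltW | lra].
Qed.
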